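(* The bound $D\le \frac{4n^2}{3m}$ for connected planar graphs is asymptotically tight: for every integer $n\ge 6$ divisible by $3$ there is a finite simple connected planar graph $G_n$ with $n$ vertices such that, writing $m(G_n)$ for its number of edges, $\frac{4n^2}{3\,m(G_n)\,D(G_n)}\to 1$ as $n\to\infty$ (over multiples of $3$).
   Context: $D(G)$ is the diameter of $G$: the maximum over all pairs of vertices of the distance (minimum number of edges on a path) between them. *)

(* Defs.v *)
From HB Require Import structures.
From mathcomp Require Import all_boot all_order all_algebra.
From mathcomp Require Import all_classical all_reals all_analysis.
Import Order.TTheory GRing.Theory Num.Theory.
Import numFieldNormedType.Exports.

Set Implicit Arguments.
Unset Strict Implicit.
Unset Printing Implicit Defensive.

Local Open Scope classical_set_scope.
Local Open Scope ring_scope.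

Record sgraph := SGraph {
  vertex :> finType;
  adj : rel vertex;
  adj_sym : symmetric adj;
  adj_irrefl : irreflexive adj
}.

Section Graphs.
Variable G : sgraph.

Definition edges : {set {set G}} :=
  [set [set p.1; p.2] | p : G * G & adj p.1 p.2]%SET.

Definition connected_graph : Prop := forall x y : G, connect (@adj G) x y.

(* [p] lists the vertices after [x], so [size p] is the number of edges. *)
Definition is_path (x y : G) (p : seq G) : bool :=
  [&& path (@adj G) x p, uniq (x :: p) & last x p == y].

(* A path has at most [#|G|.-1] edges, so every possible length is searched;
   the value is [#|G|] when there is no path from [x] to [y]. *)
Definition dist (x y : G) : nat :=
  find (fun k => [exists p : k.-tuple G, is_path x y p]) (iota 0 #|G|).

Definition diameter : nat := (\max_(x : G) \max_(y : G) dist x y)%N.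

End Graphs.

Section Planarity.
Variable R : realType.

(* By compactness of [0, 1], a continuous injection of it into the plane is a
   homeomorphism onto its image. *)
Definition is_arc (a b : R * R) (A : set (R * R)) : Prop :=
  exists f : R -> R * R,
    [/\ {within `[0, 1], continuous f},
        {in `[0, 1] &, injective f},
        f 0 = a, f 1 = b & A = f @` `[0, 1]].

Definition is_plane_drawing (G : sgraph)
    (pos : G -> R * R) (arc : {set G} -> set (R * R)) : Prop :=
  [/\ injective pos,
      forall x y : G, adj x y -> is_arc (pos x) (pos y) (arc [set x; y]%SET),
      forall (e : {set G}) (v : G), e \in edges G -> arc e (pos v) -> v \in e &
      forall e1 e2 : {set G}, e1 \in edges G -> e2 \in edges G -> e1 != e2 ->
        arc e1 `&` arc e2 `<=` [set pos v | v in [set` (e1 :&: e2)%SET]]].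

Definition planar (G : sgraph) : Prop :=
  exists (pos : G -> R * R) (arc : {set G} -> set (R * R)),
    is_plane_drawing pos arc.

End Planarity.

(* Main.v *)
Require Import Defs.
From HB Require Import structures.
From mathcomp Require Import all_boot all_order all_algebra.
From mathcomp Require Import all_classical all_reals all_analysis.
From mathcomp Require Import zify ring lra.
Import Order.TTheory GRing.Theory Num.Theory.
Import numFieldNormedType.Exports.

Local Open Scope classical_set_scope.
Local Open Scope ring_scope.

(** Join the integers below [n] that differ by 1, and also those below [M] that
    differ by 2 or 3.  This is a path attached to a stack of triangulated nested
    triangles, with [m = n + 2M - O(1)] and [D = (n - M) + M / 3 + O(1)].  For
    [M = n / 2] both [m] and [3D] are [2n + O(1)], which makes the product
    [3mD] asymptotic to [4n^2]; this choice of [M] maximises it.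

    The graph is planar because every vertex has at most three earlier
    neighbours, its immediate predecessors, which form a triangle whose interior
    is still empty: the new vertex is placed at the centroid of that triangle. *)

(** * Straight-line drawing in nested triangles *)

Section SpiralDrawing.
Variable R : realType.

(* The point with barycentric coordinates [(x, y, z)], for [x + y + z = 1], in
   the [v]-th triangle [P_v P_(v+1) P_(v+2)], where [P_0], [P_1], [P_2] are
   [(0, 0)], [(1, 0)], [(0, 1)] and [P_(v+3)] is the centroid of the [v]-th
   triangle.  Vertex [v] of the graph is drawn at [P_(v+3)]; the shift by 3
   makes every vertex the centroid of a triangle, so there is no base case. *)
Fixpoint bary (v : nat) (x y z : R) : R * R :=
  if v is u.+1 then bary u (z / 3) (x + z / 3) (y + z / 3) else (y, z).

Definition centroid (v : nat) : R * R := bary v 3^-1 3^-1 3^-1.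

Definition inner_triangle (v : nat) : set (R * R) :=
  [set q | exists x y z : R,
     [/\ 0 < x, 0 < y, 0 < z, x + y + z = 1 & q = bary v x y z]].

Definition lerp (t : R) (p q : R * R) : R * R :=
  ((1 - t) * p.1 + t * q.1, (1 - t) * p.2 + t * q.2).

(** Each recursion step is an invertible linear change of coordinates preserving the sum; at [v = 0]
    the point shows [y] and [z], and the common sum recovers [x]. *)
Lemma bary_inj v (x y z x' y' z' : R) :
  x + y + z = x' + y' + z' -> bary v x y z = bary v x' y' z' ->
  [/\ x = x', y = y' & z = z'].
Proof.
elim: v x y z x' y' z' => [|v IH] x y z x' y' z' /= hs.
  by move=> [hy hz]; split=> //; lra.
by move=> /IH[]; first lra; move=> h1 h2 h3; split; lra.
Qed.

Lemma lerp_bary v t (x y z x' y' z' : R) :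
  lerp t (bary v x y z) (bary v x' y' z') =
  bary v ((1 - t) * x + t * x') ((1 - t) * y + t * y') ((1 - t) * z + t * z').
Proof.
elim: v x y z x' y' z' => [//|v IH] x y z x' y' z' /=.
by rewrite IH; congr bary; field.
Qed.

Lemma lerpC t p q : lerp t p q = lerp (1 - t) q p.
Proof. by rewrite /lerp; congr pair; ring. Qed.

Lemma lerp0 p q : lerp 0 p q = p.
Proof. by case: p => p1 p2; rewrite /lerp /=; congr pair; ring. Qed.

Lemma lerp1 p q : lerp 1 p q = q.
Proof. by case: q => p1 p2; rewrite /lerp /=; congr pair; ring. Qed.

(* When [v - 3 <= u < v], vertex [u] is one of the corners of the triangle of
   [v], except that for [v < 3] some corners carry no vertex. *)
Lemma centroid_corner u v : (u < v)%N -> (v <= u + 3)%N ->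
  exists x y z : R, [/\ centroid u = bary v x y z, x + y + z = 1 &
    [\/ [/\ v = (u + 3)%N, x = 1, y = 0 & z = 0],
        [/\ v = (u + 2)%N, x = 0, y = 1 & z = 0] |
        [/\ v = (u + 1)%N, x = 0, y = 0 & z = 1]]].
Proof.
move=> uv vu.
have [->|[->|->]] : v = (u + 3)%N \/ v = (u + 2)%N \/ v = (u + 1)%N by lia.
- exists 1, 0, 0; split; [|lra|by apply: Or31].
  by rewrite /centroid !addnS addn0 /=; congr bary; field.
- exists 0, 1, 0; split; [|lra|by apply: Or32].
  by rewrite /centroid !addnS addn0 /=; congr bary; field.
- exists 0, 0, 1; split; [|lra|by apply: Or33].
  by rewrite /centroid !addnS addn0 /=; congr bary; field.
Qed.

Lemma inner_triangle_subset u v : (u <= v)%N ->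
  inner_triangle v `<=` inner_triangle u.
Proof.
move=> /subnK <-; elim: (v - u)%N => [//|k IH] q [x [y [z [x0 y0 z0 s1 ->]]]].
apply: IH; exists (z / 3), (x + z / 3), (y + z / 3); split=> //; lra.
Qed.

Lemma centroid_inner v : inner_triangle v (centroid v).
Proof. by exists 3^-1, 3^-1, 3^-1; split=> //; lra. Qed.

Lemma spoke_inner u v t : (u < v)%N -> (v <= u + 3)%N -> 0 <= t -> t < 1 ->
  inner_triangle v (lerp t (centroid v) (centroid u)).
Proof.
move=> uv vu t0 t1.
have [x [y [z [-> _ h]]]] := centroid_corner _ _ uv vu.
rewrite /centroid lerp_bary.
exists ((1 - t) * 3^-1 + t * x), ((1 - t) * 3^-1 + t * y),
  ((1 - t) * 3^-1 + t * z).
by case: h => -[_ -> -> ->]; split=> //; lra.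
Qed.

(** In the coordinates of triangle [v], a point inside triangle [v.+1] has its first coordinate
    strictly below the other two; on every spoke it is at least one of them. *)
Lemma spoke_not_inner u v t : (u < v)%N -> (v <= u + 3)%N -> 0 <= t -> t <= 1 ->
  ~ inner_triangle v.+1 (lerp t (centroid v) (centroid u)).
Proof.
move=> uv vu t0 t1.
have [x [y [z [-> _ h]]]] := centroid_corner _ _ uv vu.
rewrite /centroid lerp_bary => -[a [b [c [a0 b0 c0 s1 /=]]]].
by move=> /bary_inj; case: h => -[_ -> -> ->]; case; lra.
Qed.

Lemma centroid_not_inner v : ~ inner_triangle v.+1 (centroid v).
Proof.
move=> [a [b [c [a0 b0 c0 s1 /=]]]] /bary_inj; case; lra.
Qed.

Lemma centroid_inj : injective centroid.
Proof.
have main u v : (u < v)%N -> centroid u <> centroid v.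
  move=> uv e; apply: (@centroid_not_inner u); rewrite e.
  exact/(inner_triangle_subset _ _ uv)/centroid_inner.
by move=> u v e; case: (ltngtP u v) => // /main; rewrite e.
Qed.

Lemma spokes_meet u u' v t t' :
  (u < v)%N -> (v <= u + 3)%N -> (u' < v)%N -> (v <= u' + 3)%N -> u <> u' ->
  lerp t (centroid v) (centroid u) = lerp t' (centroid v) (centroid u') ->
  t = 0.
Proof.
move=> uv vu u'v vu' uu'.
have [x [y [z [-> _ h]]]] := centroid_corner _ _ uv vu.
have [x' [y' [z' [-> _ h']]]] := centroid_corner _ _ u'v vu'.
rewrite /centroid !lerp_bary => /bary_inj.
case: h => -[e -> -> ->]; case: h' => -[e' -> -> ->]; try lia;
  by case; lra.
Qed.

Lemma centroid_on_spoke u v w t : (u < v)%N -> (v <= u + 3)%N ->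
  0 <= t -> t <= 1 -> centroid w = lerp t (centroid v) (centroid u) ->
  w = v \/ w = u.
Proof.
move=> uv vu t0 t1 e; case: (ltngtP w v) => wv; last by left.
- right; move: t1; rewrite le_eqVlt => /predU1P[t1|t1].
    by apply: centroid_inj; rewrite e t1 lerp1.
  case: (@centroid_not_inner w); rewrite e.
  exact/(inner_triangle_subset _ _ wv)/spoke_inner.
- case: (spoke_not_inner _ _ _ uv vu t0 t1); rewrite -e.
  exact/(inner_triangle_subset _ _ wv)/centroid_inner.
Qed.

(** Apart from its earlier end, a spoke lies inside the triangle of its later end, a region avoided
    by all spokes whose later end is smaller. So for [v <> v'] only the earlier end of the later
    spoke can be shared; for [v = v'] only the common centre can. *)
Lemma spokes_cross u v u' v' t t' :
  (u < v)%N -> (v <= u + 3)%N -> (u' < v')%N -> (v' <= u' + 3)%N ->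
  0 <= t -> t <= 1 -> 0 <= t' -> t' <= 1 -> (u, v) <> (u', v') ->
  lerp t (centroid v) (centroid u) = lerp t' (centroid v') (centroid u') ->
  exists w, [/\ w = u \/ w = v, w = u' \/ w = v' &
    lerp t (centroid v) (centroid u) = centroid w].
Proof.
have lt_case a b a' b' s s' :
    (a < b)%N -> (b <= a + 3)%N -> (a' < b')%N -> (b' <= a' + 3)%N ->
    0 <= s -> s <= 1 -> 0 <= s' -> s' <= 1 -> (b < b')%N ->
    lerp s (centroid b) (centroid a) = lerp s' (centroid b') (centroid a') ->
    exists w, [/\ w = a \/ w = b, w = a' \/ w = b' &
      lerp s (centroid b) (centroid a) = centroid w].
  move=> ab ba ab' ba' s0 s1 s'0 s'1 bb' e.
  move: s'1 e; rewrite le_eqVlt => /predU1P[->|s'1] e.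
    rewrite lerp1 in e; exists a'; split=> //; last by left.
    by case: (centroid_on_spoke _ _ _ _ ab ba s0 s1 (esym e)); [right|left].
  case: (spoke_not_inner _ _ _ ab ba s0 s1); rewrite e.
  exact/(inner_triangle_subset _ _ bb')/spoke_inner.
move=> uv vu uv' vu' t0 t1 t'0 t'1 ne e.
case: (ltngtP v v') => vv'; first exact: (lt_case u v u' v' t t').
  have [w [h1 h2 h3]] :=
    lt_case u' v' u v t' t uv' vu' uv vu t'0 t'1 t0 t1 vv' (esym e).
  by exists w; split=> //; rewrite e.
subst v'; have uu' : u <> u' by move=> uu'; apply: ne; rewrite uu'.
exists v; split; [by right|by right|].
by rewrite (spokes_meet _ _ _ _ _ uv vu uv' vu' uu' e) lerp0.
Qed.

Lemma lerp_arc p q : p <> q ->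
  is_arc p q [set lerp t p q | t in `[0, 1]].
Proof.
move=> pq; exists (fun t => lerp t p q); split; rewrite ?lerp0 ?lerp1 //.
  apply: continuous_subspaceT => t.
  have c (a b : R) : continuous (fun t : R => (1 - t) * a + t * b).
    move=> u; apply: cvgD; apply: cvgM; try exact: cvg_cst; last exact: cvg_id.
    by apply: cvgB; [exact: cvg_cst|exact: cvg_id].
  exact: (cvg_pair (c p.1 q.1 t) (c p.2 q.2 t)).
case: p q pq => [p1 p2] [q1 q2] pq s t _ _; rewrite /lerp /= => -[h1 h2].
(* Distinct parameters would allow division by [s - t], forcing the endpoints to coincide. *)
apply/eqP; rewrite -subr_eq0; apply/negP => /negP st; apply: pq.
have e1 : (s - t) * (q1 - p1) = 0 by lra.
have e2 : (s - t) * (q2 - p2) = 0 by lra.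
move/eqP: e1; move/eqP: e2; rewrite !mulf_eq0 (negbTE st) /= !subr_eq0.
by move=> /eqP -> /eqP ->.
Qed.

End SpiralDrawing.

(** * Planarity from a numbering of bandwidth three *)

Lemma bandwidth3_planar (R : realType) (G : sgraph) (h : G -> nat) :
  injective h -> (forall x y : G, adj x y -> (h x <= h y + 3)%N) ->
  planar R G.
Proof.
move=> h_inj h_adj.
pose pos (x : G) : R * R := centroid R (h x).
pose arc (e : {set G}) : set (R * R) := [set q | exists x y : G, exists t : R,
  [/\ e = [set x; y]%SET, 0 <= t, t <= 1 & q = lerp R t (pos x) (pos y)]].
have edge_ends (e : {set G}) : e \in edges G ->
    exists x y : G, [/\ e = [set x; y]%SET, (h y < h x)%N & (h x <= h y + 3)%N].
  case/imsetP => -[x y] /=; rewrite inE /= => a ->.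
  have a' : adj y x by rewrite adj_sym.
  case: (ltngtP (h x) (h y)) => xy.
  - by exists y, x; rewrite finset.setUC; split=> //; exact: h_adj.
  - by exists x, y; split=> //; exact: h_adj.
  - by move: a; rewrite (h_inj _ _ xy) adj_irrefl.
have arcE (x y : G) : arc [set x; y]%SET =
    [set lerp R t (pos x) (pos y) | t in `[0, 1]].
  apply/seteqP; split=> q /=; last first.
    move=> [t]; rewrite in_itv /= => /andP[t0 t1] <-.
    by exists x, y, t.
  move=> [x' [y' [t [e t0 t1 ->]]]].
  have : (x' \in [set x; y]%SET) && (y' \in [set x; y]%SET).
    by rewrite e !inE !eqxx orbT.
  have : (x \in [set x'; y']%SET) && (y \in [set x'; y']%SET).
    by rewrite -e !inE !eqxx orbT.
  rewrite !inE => /andP[/orP[]/eqP ? /orP[]/eqP ?] /andP[/orP[]/eqP ? /orP[]/eqP ?];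
    subst; try by exists t => //; rewrite in_itv /= t0 t1.
  by exists (1 - t); [rewrite in_itv /=; apply/andP; split; lra|rewrite -lerpC].
exists pos, arc; split.
- by move=> x y /centroid_inj /h_inj.
- move=> x y a; rewrite arcE; apply: lerp_arc => /centroid_inj /h_inj xy.
  by move: a; rewrite xy adj_irrefl.
- move=> e v /edge_ends[x [y [-> yx xy]]]; rewrite arcE => -[t].
  rewrite /= in_itv /= => /andP[t0 t1] /esym e1.
  by case: (centroid_on_spoke _ _ _ _ _ yx xy t0 t1 e1) => /h_inj ->;
    rewrite !inE eqxx ?orbT.
- move=> e1 e2 /edge_ends[x1 [y1 [-> yx1 xy1]]] /edge_ends[x2 [y2 [-> yx2 xy2]]].
  move=> ne q []; rewrite !arcE => -[t] /=; rewrite in_itv /= => /andP[t0 t1] <-.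
  move=> [t']; rewrite in_itv /= => /andP[t'0 t'1] /esym e.
  have [|w [w1 w2 ew]] :=
      spokes_cross _ _ _ _ _ _ _ yx1 xy1 yx2 xy2 t0 t1 t'0 t'1 _ e.
    by case=> /h_inj ey /h_inj ex; rewrite ex ey eqxx in ne.
  have [v [vw v1]] : exists v, h v = w /\ v \in [set x1; y1]%SET.
    by case: w1 => ->; [exists y1|exists x1]; rewrite !inE eqxx ?orbT.
  exists v; last by rewrite ew /pos vw.
  rewrite /= inE v1 /= !inE.
  by case: w2; rewrite -vw => /h_inj ->; rewrite eqxx ?orbT.
Qed.

(** * Walks, distances and Lipschitz functions *)

Section Distances.
Local Open Scope nat_scope.
Variable G : sgraph.
Implicit Types (x y z : G) (s : nat).

Definition walk s x y : Prop :=
  exists p : seq G, [/\ path (@adj G) x p, last x p = y & size p = s].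

Lemma walk0 x : walk 0 x x.
Proof. by exists [::]. Qed.

Lemma walk1 x y : adj x y -> walk 1 x y.
Proof. by move=> a; exists [:: y]; rewrite /= a. Qed.

Lemma walk_cat s s' x y z : walk s x y -> walk s' y z -> walk (s + s') x z.
Proof.
move=> [p [pp <- <-]] [q [pq <- <-]].
by exists (p ++ q); rewrite cat_path pp pq last_cat size_cat.
Qed.

Lemma walk_sym s x y : walk s x y -> walk s y x.
Proof.
elim: s x y => [|s IH] x y [p []]; first by case: p => //= _ <- _; exact: walk0.
case: p => //= z p /andP[xz pz] lz [ps].
rewrite -addn1; apply: (@walk_cat _ _ _ z); first by apply: IH; exists p.
by apply: walk1; rewrite adj_sym.
Qed.

(** Shortening the walk gives a simple path, whose length is below [#|G|] and hence among those
    searched by [dist]. *)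
Lemma dist_le s x y : walk s x y -> dist x y <= s.
Proof.
move=> [p [pp ly <-]]; move: ly; case/shortenP: pp => q pq uq sub ly.
have sq : size q <= size p by apply: uniq_leq_size => //; case/andP: uq.
apply: leq_trans sq; rewrite leqNgt; apply/negP => lt.
have sG : size q < #|G| by rewrite -[(size q).+1]/(size (x :: q)) -(card_uniqP uq) max_card.
have /= := before_find 0 lt; rewrite nth_iota // add0n => /negbT/negP; apply.
by apply/fintype.existsP; exists (in_tuple q); rewrite /is_path pq uq ly eqxx.
Qed.

(** The hypothesis excludes the default value [#|G|], so the search stopped at a realised length. *)
Lemma walk_dist x y : dist x y < #|G| -> walk (dist x y) x y.
Proof.
move=> lt; rewrite /dist in lt *.
set a := (fun k => _) in lt *.
have h : has a (iota 0 #|G|) by rewrite has_find size_iota.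
have := nth_find 0 h; rewrite nth_iota // add0n => /fintype.existsP[p /and3P[pp _ /eqP ly]].
by exists p; split=> //; exact: size_tuple.
Qed.

Lemma diameter_le d : (forall x y, dist x y <= d) -> diameter G <= d.
Proof. by move=> h; apply/bigmax_leqP => x _; apply/bigmax_leqP => y _. Qed.

Lemma dist_le_diameter x y : dist x y <= diameter G.
Proof.
apply: leq_trans (leq_bigmax (F := fun x => \max_(y : G) dist x y) x).
exact: (leq_bigmax (F := fun y => dist x y) y).
Qed.

Lemma lipschitz_walk (f : G -> nat) c s x y :
  (forall u v, adj u v -> f v <= f u + c) -> walk s x y -> f y <= f x + s * c.
Proof.
move=> lip [p [pp <- <-]]; elim: p x pp => [|z p IH] x /=; first by rewrite addn0.
by move=> /andP[/lip h /IH]; lia.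
Qed.

Lemma lipschitz_dist (f : G -> nat) c x y : connect (@adj G) x y ->
  (forall u v, adj u v -> f v <= f u + c) -> f y <= f x + dist x y * c.
Proof.
move=> /connectP[p pp ->] lip; apply: lipschitz_walk => //; apply: walk_dist.
case/shortenP: pp => q pq uq _.
apply: (@leq_ltn_trans (size q)); first by apply: dist_le; exists q.
by rewrite -[(size q).+1]/(size (x :: q)) -(card_uniqP uq) max_card.
Qed.

End Distances.

(** Each edge is counted once, at its larger end [j]; the inner sum is then the number of earlier
    neighbours of [j]. *)
Lemma card_edges_ord n (e : rel 'I_n) (e_sym : symmetric e) (e_irr : irreflexive e) :
  #|edges (SGraph e_sym e_irr)| =
  (\sum_(j < n) \sum_(i < n) [&& i < j & e i j])%N.
Proof.
pose S := [set p : 'I_n * 'I_n | (p.1 < p.2)%N && e p.1 p.2]%SET.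
have -> : edges (SGraph e_sym e_irr) = [set [set p.1; p.2]%SET | p in S]%SET.
  apply/setP => A; apply/imsetP/imsetP => -[[i j]]; rewrite !inE /=.
    move=> a ->; case: (ltngtP i j) => ij.
    - by exists (i, j); rewrite // inE /= ij.
    - by exists (j, i); rewrite /= 1?finset.setUC // inE /= ij e_sym.
    - by move: a; rewrite (val_inj ij) e_irr.
  by move=> /andP[_ a] ->; exists (i, j); rewrite ?inE.
rewrite card_in_imset.
  rewrite -sum1_card big_mkcond exchange_big pair_big /=.
  by apply: eq_bigr => -[i j] _; rewrite inE /=; case: (_ && _).
move=> [i j] [i' j']; rewrite !inE /= => /andP[ij _] /andP[ij' _] E.
have : (i \in [set i'; j']%SET) && (j \in [set i'; j']%SET).
  by rewrite -E !inE !eqxx orbT.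
rewrite !inE => /andP[/orP[]/eqP ? /orP[]/eqP ?]; subst=> //; lia.
Qed.

(** * The spiral graphs and their edge count *)

Definition spiral_adj M n : rel 'I_n := fun i j =>
  (i != j) && (((i <= j + 1) && (j <= i + 1)) ||
               [&& i < M, j < M, i <= j + 3 & j <= i + 3])%N.

Lemma spiral_adj_sym M n : symmetric (spiral_adj M n).
Proof. by move=> i j; rewrite /spiral_adj eq_sym; congr andb; lia. Qed.

Lemma spiral_adj_irrefl M n : irreflexive (spiral_adj M n).
Proof. by move=> i; rewrite /spiral_adj eqxx. Qed.

Definition spiral M n : sgraph :=
  SGraph (spiral_adj_sym M n) (spiral_adj_irrefl M n).

Lemma sum_ord_interval n d K : (d <= K)%N -> (K <= n)%N ->
  (\sum_(j < n) (d <= j < K))%N = (K - d)%N.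
Proof.
move=> dK Kn.
suff -> : (\sum_(j < n) (d <= j < K) = minn n K - minn n d)%N by lia.
elim: n {Kn} => [|n IH]; first by rewrite big_ord0; lia.
by rewrite big_ord_recr /= IH; lia.
Qed.

(** Earlier neighbours at difference 1, 2 and 3 exist for [n - 1], [M - 2] and [M - 3] vertices
    respectively, whence the 6. *)
Lemma card_spiral_edges M n : (3 <= M)%N -> (M <= n)%N ->
  (#|edges (spiral M n)| + 6 = n + 2 * M)%N.
Proof.
move=> M3 Mn; rewrite card_edges_ord.
under eq_bigr => j _.
  rewrite (_ : (\sum_(i < n) _ =
      (1 <= j < n) + (2 <= j < M) + (3 <= j < M))%N); last first.
    (* Each possible neighbour is an interval of length one, which truncated subtraction empties
       when the neighbour would be negative. *)
    transitivity (\sum_(i < n) ((j - 1 <= i < j) +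
        ((j - 2 <= i < j - 1) && (j < M)) +
        ((j - 3 <= i < j - 2) && (j < M))))%N.
      apply: eq_bigr => i _; rewrite /spiral_adj.
      rewrite (_ : (i != j) = (nat_of_ord i != nat_of_ord j)) //.
      by have := ltn_ord i; have := ltn_ord j; lia.
    have := ltn_ord j => jn.
    rewrite !big_split /= sum_ord_interval; [|lia|lia].
    case: (ltnP j M) => jM.
      under eq_bigr do rewrite andbT.
      under [X in (_ + X)%N]eq_bigr do rewrite andbT.
      by rewrite !sum_ord_interval; lia.
    under eq_bigr do rewrite andbF.
    under [X in (_ + X)%N]eq_bigr do rewrite andbF.
    by rewrite !big1 //; lia.
  over.
rewrite !big_split /= !sum_ord_interval; lia.
Qed.

(** * Diameter of the spiral graphs *)

Lemma spiral_step_walk M n d k : (0 < k)%N ->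
  (forall i j : 'I_n, j = (i + k)%N :> nat -> (j < d)%N -> spiral_adj M n i j) ->
  forall s (i j : 'I_n), j = (i + s * k)%N :> nat -> (j < d)%N ->
  walk (spiral M n) s i j.
Proof.
move=> k0 step; elim=> [|s IH] i j ij jd.
  have -> : j = i by apply: val_inj; rewrite /= ij mul0n addn0.
  exact: walk0.
have ltl : (i + s * k < n)%N by have := ltn_ord j; lia.
rewrite -addn1; apply: (@walk_cat (spiral M n) _ _ _ (Ordinal ltl)).
  by apply: IH => //=; lia.
by apply: walk1; apply: step => //=; lia.
Qed.

(** Steps of 3 are taken while they stay at or below [M.-1], then unit steps; each long step saves
    2. For [i] beyond [M.-1] truncation leaves no long step. *)
Lemma spiral_walk M n (i j : 'I_n) : (i <= j)%N ->
  walk (spiral M n) (j - i - 2 * ((minn j M.-1 - i) %/ 3)) i j.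
Proof.
move=> ij; set k := (_ %/ 3)%N.
have hk : (i + k * 3 <= j)%N by lia.
have kn : (i + k * 3 < n)%N by have := ltn_ord j; lia.
rewrite (_ : j - i - 2 * k = k + (j - (i + k * 3)))%N; last by lia.
apply: (@walk_cat (spiral M n) _ _ _ (Ordinal kn)).
  have [k0|k0] := posnP k.
    have -> : Ordinal kn = i by apply: val_inj; rewrite /= k0 mul0n addn0.
    by rewrite k0; exact: walk0.
  apply: (@spiral_step_walk _ _ M 3) => //=; last by lia.
  move=> u v uv vM; rewrite /spiral_adj.
  by rewrite (_ : (u != v) = (nat_of_ord u != nat_of_ord v)) //; lia.
apply: (@spiral_step_walk _ _ n 1) => //=; last by lia.
move=> u v uv vM; rewrite /spiral_adj.
by rewrite (_ : (u != v) = (nat_of_ord u != nat_of_ord v)) //; lia.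
Qed.

Lemma spiral_connected M n : connected_graph (spiral M n).
Proof.
have main (x y : spiral M n) s : walk _ s x y -> connect (@adj (spiral M n)) x y.
  by move=> [p [pp ly _]]; apply/connectP; exists p.
move=> x y; case: (leqP (x : 'I_n) (y : 'I_n)) => [|/ltnW] xy.
  exact: main (spiral_walk M _ _ _ xy).
exact: main (walk_sym _ _ _ _ (spiral_walk M _ _ _ xy)).
Qed.

Lemma diameter_spiral_ub M n : (M <= n)%N ->
  (3 * diameter (spiral M n) + 2 * M <= 3 * n + 6)%N.
Proof.
move=> Mn.
suff : (diameter (spiral M n) <= (3 * n + 6 - 2 * M) %/ 3)%N by lia.
apply: diameter_le => x y.
have main (i j : 'I_n) : (i <= j)%N ->
    (j - i - 2 * ((minn j M.-1 - i) %/ 3) <= (3 * n + 6 - 2 * M) %/ 3)%N.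
  by have := ltn_ord j; lia.
case: (leqP (x : 'I_n) (y : 'I_n)) => [|/ltnW] xy;
  apply: leq_trans (main _ _ xy); apply: dist_le; first exact: spiral_walk.
exact/walk_sym/spiral_walk.
Qed.

Lemma diameter_spiral_lb M n : (0 < M)%N -> (M < n)%N ->
  (3 * n <= 3 * diameter (spiral M n) + 2 * M + 3)%N.
Proof.
move=> M0 Mn; case: n Mn => // n Mn.
(* Stretching the tail by 3 makes [f] change by at most 3 along every edge, while it rises from 0 at
   [ord0] to [3n - 2M] at [ord_max]. *)
pose f (i : 'I_n.+1) := (if i < M then i : nat else M + 3 * (i - M))%N.
have lip (u v : spiral M n.+1) : adj u v -> (f v <= f u + 3)%N.
  rewrite /= /spiral_adj /f => /andP[_].
  by case: ifP => ?; case: ifP => ?; lia.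
have := @lipschitz_dist (spiral M n.+1) f 3 ord0 ord_max (spiral_connected _ _ _ _) lip.
have := @dist_le_diameter (spiral M n.+1) ord0 ord_max.
rewrite /f /= M0; case: ifP => ?; lia.
Qed.

(** * Asymptotics *)

Lemma near_linear_ratio (R : realType) (u : nat -> nat) (c : nat) :
  (\forall n \near \oo, (u n <= 2 * n + c)%N /\ (2 * n <= u n + c)%N) ->
  (2 * n%:R / (u n)%:R : R) @[n --> \oo] --> (1 : R).
Proof.
move=> h.
(* The inverse ratio has the explicit denominator [2n], so it can be squeezed between [1 - c/n] and
   [1 + c/n]. *)
have hu : ((u n)%:R / (2 * n%:R) : R) @[n --> \oo] --> (1 : R).
  have cn : (c%:R * n.+1%:R^-1 : R) @[n --> \oo] --> (0 : R).
    rewrite -(mulr0 c%:R); apply: cvgM; first exact: cvg_cst.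
    exact: cvg_harmonic.
  have cn1 : (c%:R * n%:R^-1 : R) @[n --> \oo] --> (0 : R).
    by rewrite -(cvg_shiftS (fun n => c%:R * n%:R^-1 : R)).
  have lo : (1 - c%:R * n%:R^-1 : R) @[n --> \oo] --> (1 : R).
    by rewrite -[X in _ --> X]subr0; apply: cvgB => //; exact: cvg_cst.
  have hi : (1 + c%:R * n%:R^-1 : R) @[n --> \oo] --> (1 : R).
    by rewrite -[X in _ --> X]addr0; apply: cvgD => //; exact: cvg_cst.
  apply: squeeze_cvgr lo hi; near=> n.
  have n0 : (0 < n)%N by near: n; exists 1%N.
  have [h1 h2] : (u n <= 2 * n + c)%N /\ (2 * n <= u n + c)%N by near: n.
  move: h1 h2; rewrite -!(ler_nat R) !(natrD _ _ c) !natrM => h1 h2.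
  have n0R : (0 : R) < n%:R by rewrite ltr0n.
  have c0 : (0 : R) <= c%:R by [].
  rewrite ler_pdivlMr ?mulr_gt0 // ler_pdivrMr ?mulr_gt0 //.
  have -> : (1 - c%:R * n%:R^-1) * (2 * n%:R) = 2 * n%:R - 2 * c%:R :> R.
    by field; rewrite gt_eqF.
  have -> : (1 + c%:R * n%:R^-1) * (2 * n%:R) = 2 * n%:R + 2 * c%:R :> R.
    by field; rewrite gt_eqF.
  by apply/andP; split; lra.
have := cvgV (oner_neq0 R) hu; rewrite invr1 => hV.
by apply: (cvg_trans _ (hV _)); apply: near_eq_cvg; near=> n; rewrite /= invf_div.
Unshelve. all: by end_near.
Qed.

Theorem mainTheorem5 (R : realType) :
  exists G : nat -> sgraph,
    (forall n : nat, (6 <= n)%N -> (3 %| n)%N ->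
       [/\ #|G n| = n, connected_graph (G n) & planar R (G n)]) /\
    (4 * n%:R ^+ 2 / (3 * #|edges (G n)|%:R * (diameter (G n))%:R) : R)
      @[n --> within [set k : nat | (3 %| k)%N] \oo] --> (1 : R).
Proof.
exists (fun n => spiral n./2 n); split=> [n _ _|].
  split; [exact: card_ord|exact: spiral_connected|].
  apply: (@bandwidth3_planar R (spiral n./2 n) (@nat_of_ord n)); first exact: val_inj.
  by move=> x y; rewrite /= /spiral_adj => /andP[_]; lia.
(* Convergence is proved along all [n], not only multiples of 3. *)
apply: cvg_within_filter.
have he : (2 * n%:R / (#|edges (spiral n./2 n)|)%:R : R) @[n --> \oo] --> (1 : R).
  (* The edge count is [2n - 6] or, for odd [n], [2n - 7]; [6 <= n] ensures [3 <= n./2]. *)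
  apply: (@near_linear_ratio R _ 7); exists 6%N => // n /= n6.
  by have := @card_spiral_edges n./2 n; move: #|edges _| => k; lia.
have hd : (2 * n%:R / (3 * diameter (spiral n./2 n))%:R : R) @[n --> \oo] --> (1 : R).
  (* The two diameter bounds give [2n - 3 <= 3D <= 2n + 7], with 7 coming from odd [n]. *)
  apply: (@near_linear_ratio R _ 7); exists 6%N => // n /= n6.
  have := @diameter_spiral_ub n./2 n; have := @diameter_spiral_lb n./2 n.
  by move: (diameter _) => k; lia.
have := cvgM he hd; rewrite mulr1 => hM.
apply: (cvg_trans _ (hM _)); apply: near_eq_cvg.
by near=> n; rewrite /= mulf_div natrM; congr (_ / _); ring.
Unshelve. all: by end_near.
Qed.
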